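(* Let $C$ be a finite skew brace with $(C,+)=A$ and $(C,\circ)=R$, let $T$ be a non-trivial finite abelian group with underlying set $\Omega$, and let $\chi:R\to T$ be a surjective homomorphism. Then the diagonal subgroup $\Delta(A)=\{(a)_{x\in\Omega}:a\in A\}\le A^\Omega$ is a subbrace of $\mathsf{K}_T(C,\chi)$, and the map $C\to\Delta(A)$, $a\mapsto(a)_{x\in\Omega}$, is an isomorphism of skew braces.
   Context: A skew brace is a triple $(B,+,\circ)$ such that $(B,+)$ and $(B,\circ)$ are groups (neither assumed abelian) on the same set and $a\circ(b+c)=a\circ b-a+a\circ c$ for all $a,b,c\in B$. Its lambda map is the homomorphism $\lambda^B:(B,\circ)\to\mathrm{Aut}(B,+)$, $\lambda^B_a(b)=-a+a\circ b$. A subbrace is a subset that is a subgroup of both $(B,+)$ and $(B,\circ)$. The kernel--wreath skew brace $\mathsf{K}_T(C,\chi)$: let $\pi:R\to A$ be the identity map on the underlying set of $C$. The group $T$ acts on $R^\Omega$ by ${}^u(r_x)_{x\in\Omega}=(r_{u^{-1}x})_{x\in\Omega}$; let $W=R^\Omega\rtimes T$, with $(r,u)(s,v)=(r\,{}^us,uv)$. The group $W$ acts on $A^\Omega$ by $(r,u)\cdot(a_x)_x=\big(\pi(r_x)+\lambda^C_{r_x}(a_{u^{-1}x})\big)_x$. Let $\varepsilon:W\to T$ be the homomorphism $\varepsilon((r_x)_x,u)=\big(\prod_{x\in\Omega}\chi(r_x)\big)u$ and $G=\ker\varepsilon$. The group $G$ acts regularly on $A^\Omega$, and $\Pi:G\to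 A^\Omega$, $\Pi((r_x)_x,u)=(\pi(r_x))_x$, is a bijection. Then $\mathsf{K}_T(C,\chi)$ is the skew brace with underlying set $A^\Omega$, whose addition is that of the direct product $A^\Omega$ and whose multiplication is the group structure of $G$ transported along $\Pi$. *)

(* Defs.v *)
From HB Require Import structures.
From mathcomp Require Import all_boot all_fingroup.

Set Implicit Arguments.
Unset Strict Implicit.
Unset Printing Implicit Defensive.

Import Algebra.

Local Open Scope ring_scope.

(* Additive groups that need not be abelian. The operations + and 0 are those of
   [baseAddUMagmaType], which carries no axioms; [zmodType] would force + to be
   commutative. The opposite is a separate operation because [baseZmodType]
   cannot be joined with [choiceType]. *)
HB.mixin Record isAddGroup A of ChoiceBaseAddUMagma A := {
  sopp : A -> A;
  saddA : associative (@add A);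
  sadd0 : left_id 0 (@add A);
  saddN : left_inverse 0 sopp (@add A)
}.

#[short(type="addGroupType")]
HB.structure Definition AddGroup := { A of ChoiceBaseAddUMagma A & isAddGroup A }.

Local Notation "- x" := (sopp x) : ring_scope.
Local Notation "x - y" := (x + - y) : ring_scope.

(* A itself, with its addition as group law. The library's [to_multiplicative]
   gets a group law for abelian groups only. *)
Definition add_group (A : Type) : Type := A.

Section AddGroupTheory.

Variable A : addGroupType.
Implicit Types a b c : A.

Lemma saddKN a b : - a + (a + b) = b.
Proof. by rewrite saddA saddN sadd0. Qed.

Lemma saddI a : injective (+%R a).
Proof. by move=> b c /(congr1 (+%R (- a))); rewrite !saddKN. Qed.

Lemma saddr0 a : a + 0 = a.
Proof. by apply: (@saddI (- a)); rewrite saddA saddN sadd0. Qed.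

Lemma saddrN a : a - a = 0.
Proof. by apply: (@saddI (- a)); rewrite saddKN saddr0. Qed.

Lemma saddNK a b : a + (- a + b) = b.
Proof. by rewrite saddA saddrN sadd0. Qed.

HB.instance Definition _ := Choice.on (add_group A).
HB.instance Definition _ :=
  isGroup.Build (add_group A) saddA sadd0 saddr0 saddN saddrN.

End AddGroupTheory.

Local Notation "x ∘ y" := (x * y)%g (at level 40, left associativity).

HB.mixin Record isSkewBrace B of monoid.Group B & AddGroup B := {
  smulD : forall a b c : B, a ∘ (b + c) = a ∘ b - a + a ∘ c
}.

#[short(type="skewBraceType")]
HB.structure Definition SkewBrace :=
  { B of monoid.Group B & AddGroup B & isSkewBrace B }.

#[short(type="finSkewBraceType")]
HB.structure Definition FinSkewBrace := { B of SkewBrace B & Finite B }.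

Section SkewBraceTheory.

Variable B : skewBraceType.
Implicit Types a b c : B.

Definition lambda a b : B := - a + a ∘ b.

Lemma smul0 a : a ∘ 0 = a.
Proof.
have /(congr1 (+%R (- (a ∘ 0)))) := smulD a 0 0.
by rewrite sadd0 -saddA saddKN saddN => /(congr1 (+%R a)); rewrite saddNK saddr0.
Qed.

Lemma sone0 : 1%g = 0 :> B.
Proof. by rewrite -[RHS]mul1g smul0. Qed.

Lemma add_lambda a b : a + lambda a b = a ∘ b.
Proof. exact: saddNK. Qed.

Lemma lambdaD a : {morph lambda a : b c / b + c}.
Proof. by move=> b c; rewrite /lambda smulD !saddA. Qed.

Lemma lambdaM a b c : lambda (a ∘ b) c = lambda a (lambda b c).
Proof.
apply: (@saddI _ (a ∘ b)); rewrite add_lambda -mulgA -(add_lambda b c) smulD.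
by rewrite -saddA.
Qed.

End SkewBraceTheory.

Section Subbrace.

Variable B : skewBraceType.

Definition is_subbrace (S : {pred B}) :=
  group_closed S /\ group_closed (S : {pred add_group B}).

Variables (S : {pred B}) (hS : is_subbrace S).

Definition subbrace := let _ := hS in {x | x \in S}.

HB.instance Definition _ := SubChoice.on subbrace.
HB.instance Definition _ :=
  SubChoice_isSubGroup.Build B S subbrace (proj1 hS).

Let hSadd : group_closed (S : {pred add_group B}) := proj2 hS.

Definition subbrace_add (x y : subbrace) : subbrace :=
  Sub (val x + val y) (group_closedM hSadd (valP x) (valP y)).

Definition subbrace_zero : subbrace := Sub 0 (proj1 hSadd).

Definition subbrace_opp (x : subbrace) : subbrace :=
  Sub (- val x) (group_closedV hSadd (valP x)).

HB.instance Definition _ := hasAdd.Build subbrace subbrace_add.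
HB.instance Definition _ := hasZero.Build subbrace subbrace_zero.

Lemma val_add (x y : subbrace) : val (x + y) = val x + val y.
Proof. by []. Qed.

Lemma val_mul (x y : subbrace) : val (x ∘ y) = val x ∘ val y.
Proof. by []. Qed.

Fact subbrace_saddA : associative (@add subbrace).
Proof. by move=> x y z; apply: val_inj; rewrite !val_add saddA. Qed.

Fact subbrace_sadd0 : left_id 0 (@add subbrace).
Proof. by move=> x; apply: val_inj; rewrite val_add sadd0. Qed.

Fact subbrace_saddN : left_inverse 0 subbrace_opp (@add subbrace).
Proof. by move=> x; apply: val_inj; rewrite val_add /= saddN. Qed.

HB.instance Definition _ := isAddGroup.Build subbrace
  subbrace_saddA subbrace_sadd0 subbrace_saddN.

Fact subbrace_smulD (a b c : subbrace) : a ∘ (b + c) = a ∘ b - a + a ∘ c.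
Proof. by apply: val_inj; rewrite val_mul !val_add !val_mul smulD. Qed.

HB.instance Definition _ := isSkewBrace.Build subbrace subbrace_smulD.

End Subbrace.

Definition skew_brace_isom (B C : skewBraceType) (f : B -> C) :=
  [/\ {morph f : x y / x + y}, {morph f : x y / x ∘ y} & bijective f].

(* R^T ⋊ T, with T acting on R^T by left translation of the indices. *)
Definition wreath (R : groupType) (T : finGroupType) : Type :=
  ({ffun T -> R} * T)%type.

Section Wreath.

Variables (R : groupType) (T : finGroupType).
Local Notation W := (wreath R T).

Definition shift (u : T) (r : {ffun T -> R}) : {ffun T -> R} :=
  [ffun x => r (u^-1 * x)%g].

Definition wmul (w z : W) : W := ((w.1 * shift w.2 z.1)%g, (w.2 * z.2)%g).
Definition wone : W := (1%g, 1%g).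
Definition winv (w : W) : W := (shift w.2^-1 w.1^-1, w.2^-1)%g.

HB.instance Definition _ := Choice.on W.

Fact wmulA : associative wmul.
Proof.
move=> [r u] [s v] [t w]; congr (_, _); last exact: mulgA.
by apply/ffunP=> x; rewrite !ffunE invMg !mulgA.
Qed.

Fact wmul1 : left_id wone wmul.
Proof.
move=> [r u]; congr (_, _); last exact: mul1g.
by apply/ffunP=> x; rewrite !ffunE invg1 !mul1g.
Qed.

Fact wmulr1 : right_id wone wmul.
Proof.
move=> [r u]; congr (_, _); last exact: mulg1.
by apply/ffunP=> x; rewrite !ffunE mulg1.
Qed.

Fact wmulV : left_inverse wone winv wmul.
Proof.
move=> [r u]; congr (_, _); last exact: mulVg.
by apply/ffunP=> x; rewrite !ffunE mulVg.
Qed.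

Fact wmulrV : right_inverse wone winv wmul.
Proof.
move=> [r u]; congr (_, _); last exact: mulgV.
by apply/ffunP=> x; rewrite !ffunE invgK mulKVg mulgV.
Qed.

HB.instance Definition _ := isGroup.Build W wmulA wmul1 wmulr1 wmulV wmulrV.

End Wreath.

Section KernelWreath.

Variables (C : skewBraceType) (T : finGroupType) (abT : abelian [set: T]).
Variable chi : {multiplicative C -> T}.

Local Notation W := (wreath C T).

Definition wact (w : W) (a : {ffun T -> C}) : {ffun T -> C} :=
  [ffun x => w.1 x + lambda (w.1 x) (a (w.2^-1 * x)%g)].

Lemma wactE w a x : wact w a x = w.1 x ∘ a (w.2^-1 * x)%g.
Proof. by rewrite ffunE add_lambda. Qed.

Lemma wact1 : wact 1%g =1 id.
Proof. by move=> a; apply/ffunP=> x; rewrite wactE ffunE invg1 !mul1g. Qed.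

Lemma wactM w z a : wact (w * z)%g a = wact w (wact z a).
Proof. by apply/ffunP=> x; rewrite !wactE !ffunE invMg !mulgA. Qed.

Definition eps (w : W) : T := ((\prod_x chi (w.1 x)) * w.2)%g.

Lemma mulTC : commutative (@mul T).
Proof. by move=> u v; apply: (centsP abT); rewrite inE. Qed.

Lemma epsM : {morph eps : w z / (w * z)%g}.
Proof.
move=> [r u] [s v]; rewrite /eps /=.
pose mulT : Monoid.com_law (1%g : T) :=
  HB.pack (@mul T) (SemiGroup.isCommutativeLaw.Build _ _ mulTC).
have -> : (\prod_x chi ((r * shift u s)%g x) =
          (\prod_x chi (r x)) * (\prod_x chi (s x)))%g.
  under eq_bigr do rewrite ffunE gmulfM.
  rewrite (@big_split _ _ mulT) /=; congr (_ * _)%g.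
  have /= -> := reindex_inj (op := mulT) (P := xpredT)
    (F := fun x => chi (s x)) (mulgI u^-1%g).
  by apply: eq_bigr => x _; rewrite ffunE.
by rewrite -!mulgA; congr (_ * _)%g; rewrite !mulgA; congr (_ * _)%g; exact: mulTC.
Qed.

Lemma eps1 : eps 1%g = 1%g.
Proof. by apply: (mulgI (eps 1%g)); rewrite -epsM !mulg1. Qed.

Lemma epsV w : eps w^-1%g = (eps w)^-1%g.
Proof. by apply: (mulgI (eps w)); rewrite -epsM !mulgV eps1. Qed.

Definition eps_ker : {pred W} := [pred w | eps w == 1%g].

Fact eps_ker_group_closed : group_closed eps_ker.
Proof.
split=> [|w z]; first by rewrite inE eps1.
by rewrite !inE epsM epsV => /eqP-> /eqP->; rewrite mulgV.
Qed.

Definition kw_group := let _ := abT in {w | w \in eps_ker}.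

HB.instance Definition _ := SubChoice.on kw_group.
HB.instance Definition _ :=
  SubChoice_isSubGroup.Build W eps_ker kw_group eps_ker_group_closed.

Definition Pi (g : kw_group) : {ffun T -> C} := (val g).1.

Fact Pi_inv_subproof (a : {ffun T -> C}) :
  (a, (\prod_x chi (a x))^-1%g) \in eps_ker.
Proof. by rewrite inE /eps /= mulgV. Qed.

Definition Pi_inv a : kw_group := Sub (_, _) (Pi_inv_subproof a).

Lemma Pi_invK : cancel Pi_inv Pi.
Proof. by []. Qed.

Lemma PiK : cancel Pi Pi_inv.
Proof.
case=> -[r u] ker_ru; apply: val_inj; congr (_, _) => /=.
have /eqP : eps (r, u) == 1%g := ker_ru.
rewrite /eps /= => ru1.
by apply: (mulgI (\prod_x chi (r x))%g); rewrite mulgV ru1.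
Qed.

Lemma PiM g h : Pi (g * h)%g = wact (val g) (Pi h).
Proof. by apply/ffunP=> x; rewrite wactE !ffunE. Qed.

Lemma wact_regular a b : exists! g : kw_group, wact (val g) a = b.
Proof.
exists (Pi_inv b * (Pi_inv a)^-1)%g; split=> [|g <-].
  by rewrite -{2}(Pi_invK a) -PiM -mulgA mulVg mulg1.
by rewrite -{1}(Pi_invK a) -PiM PiK mulgK.
Qed.

(* The underlying set is that of the direct product; [abT] and [chi] only
   index the skew brace structure put on it. *)
Definition kernel_wreath := let _ := (abT, chi) in {ffun T -> C}.
Local Notation K := kernel_wreath.

HB.instance Definition _ := Choice.on K.

HB.instance Definition _ := hasAdd.Build K
  (fun a b : {ffun T -> C} => [ffun x => a x + b x]).
HB.instance Definition _ := hasZero.Build K [ffun=> 0].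

Definition kw_opp (a : K) : K := [ffun x => - (a : {ffun T -> C}) x].
Definition kw_mul (a b : K) : K := Pi (Pi_inv a * Pi_inv b)%g.
Definition kw_one : K := Pi 1%g.
Definition kw_inv (a : K) : K := Pi (Pi_inv a)^-1%g.

Fact kw_mulA : associative kw_mul.
Proof. by move=> a b c; rewrite /kw_mul !PiK mulgA. Qed.

Fact kw_mul1 : left_id kw_one kw_mul.
Proof. by move=> a; rewrite /kw_mul /kw_one PiK mul1g. Qed.

Fact kw_mulr1 : right_id kw_one kw_mul.
Proof. by move=> a; rewrite /kw_mul /kw_one PiK mulg1. Qed.

Fact kw_mulV : left_inverse kw_one kw_inv kw_mul.
Proof. by move=> a; rewrite /kw_mul /kw_inv PiK mulVg. Qed.

Fact kw_mulrV : right_inverse kw_one kw_inv kw_mul.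
Proof. by move=> a; rewrite /kw_mul /kw_inv PiK mulgV. Qed.

HB.instance Definition _ :=
  isGroup.Build K kw_mulA kw_mul1 kw_mulr1 kw_mulV kw_mulrV.

Lemma kw_mulE (a b : K) : a ∘ b = wact (val (Pi_inv a)) b.
Proof. exact: PiM. Qed.

Fact kw_saddA : associative (@add K).
Proof. by move=> a b c; apply/ffunP=> x; rewrite !ffunE saddA. Qed.

Fact kw_sadd0 : left_id 0 (@add K).
Proof. by move=> a; apply/ffunP=> x; rewrite !ffunE sadd0. Qed.

Fact kw_saddN : left_inverse 0 kw_opp (@add K).
Proof. by move=> a; apply/ffunP=> x; rewrite !ffunE saddN. Qed.

HB.instance Definition _ := isAddGroup.Build K kw_saddA kw_sadd0 kw_saddN.

Fact kw_smulD (a b c : K) : a ∘ (b + c) = a ∘ b - a + a ∘ c.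
Proof. by rewrite !kw_mulE; apply/ffunP=> x; rewrite !ffunE !add_lambda smulD. Qed.

HB.instance Definition _ := isSkewBrace.Build K kw_smulD.

End KernelWreath.

Section Diagonal.

Variables (C : finSkewBraceType) (T : finGroupType) (abT : abelian [set: T]).
Variable chi : {multiplicative C -> T}.

Definition diag (a : C) : kernel_wreath abT chi := [ffun _ : T => a].

Definition diagonal : {pred kernel_wreath abT chi} := [in codom diag].

Definition to_diagonal (hD : is_subbrace diagonal) (a : C) : subbrace hD :=
  Sub (diag a) (codom_f diag a).

End Diagonal.

Arguments diag {C T} abT chi a.
Arguments diagonal {C T} abT chi _.

(* Main.v *)
Require Import Defs.
From mathcomp Require Import all_boot all_fingroup.

(* In the product [diag a * diag b] the T-component of the preimage of [diag a]
   only permutes the coordinates of [diag b], which are all equal; so it is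
   [diag (a * b)] and the diagonal is the image of a homomorphism on C. *)

Import Algebra.

Section DiagonalMorphism.

Variables (C : finSkewBraceType) (T : finGroupType) (abT : abelian [set: T]).
Variable chi : {multiplicative C -> T}.

Lemma diagD : {morph diag abT chi : a b / (a + b)%R}.
Proof. by move=> a b; apply/ffunP=> x; rewrite !ffunE. Qed.

Lemma diagM : {morph diag abT chi : a b / (a * b)%g}.
Proof. by move=> a b; rewrite kw_mulE; apply/ffunP=> x; rewrite wactE !ffunE. Qed.

Lemma diag0 : diag abT chi 0%R = 0%R.
Proof. by apply/ffunP=> x; rewrite !ffunE. Qed.

Lemma diagN a : diag abT chi (sopp a) = sopp (diag abT chi a).
Proof. by apply/ffunP=> x; rewrite !ffunE. Qed.

Lemma diag1 : diag abT chi 1%g = 1%g.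
Proof. by apply: (mulgI (diag abT chi 1%g)); rewrite -diagM !mulg1. Qed.

Lemma diagV a : diag abT chi a^-1%g = (diag abT chi a)^-1%g.
Proof. by apply: (mulgI (diag abT chi a)); rewrite -diagM !mulgV diag1. Qed.

(** The index set is the group [T], hence non-empty, so reading off the coordinate at [1%g] recovers
    the element of [C]. *)
Lemma diag_inj : injective (diag abT chi).
Proof. by move=> a b /ffunP/(_ 1%g); rewrite !ffunE. Qed.

Lemma diagonal_is_subbrace : is_subbrace (diagonal abT chi).
Proof.
split; split=> [|_ _ /codomP[a ->] /codomP[b ->]].
- by rewrite -diag1; apply: codom_f.
- by rewrite -diagV -diagM; apply: codom_f.
(* From here on the group is [add_group] of the kernel-wreath brace: its [1%g] is [0] and its
   quotient is a difference, both by conversion. *)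
- by rewrite -[1%g]/(0%R : kernel_wreath abT chi) -diag0; apply: codom_f.
rewrite -[X in X \in _]/(diag abT chi a + sopp (diag abT chi b))%R.
by rewrite -diagN -diagD; apply: codom_f.
Qed.

Lemma to_diagonal_bij (hD : is_subbrace (diagonal abT chi)) :
  bijective (to_diagonal hD).
Proof.
have sD (y : subbrace hD) : val y \in codom (diag abT chi) := valP y.
(* Since [C] is finite, [iinv] picks a preimage from the membership proof [sD y]; injectivity of
   [diag] makes it the original element. *)
exists (fun y => iinv (sD y)) => [a | y].
  by apply: diag_inj; rewrite f_iinv.
by apply: val_inj; rewrite /= f_iinv.
Qed.

End DiagonalMorphism.

Theorem proposition3p6 (C : finSkewBraceType) (T : finGroupType)
    (abT : abelian [set: T]) (ntT : (1 < #|T|)%N)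
    (chi : {multiplicative C -> T})
    (chi_surj : forall t : T, exists r : C, chi r = t) :
  exists hD : is_subbrace (diagonal abT chi), skew_brace_isom (to_diagonal hD).
Proof.
exists (diagonal_is_subbrace _ _ abT chi); split=> [a b | a b |].
- by apply: val_inj; rewrite /= diagD.
- by apply: val_inj; rewrite /= diagM.
exact: to_diagonal_bij.
Qed.
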